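(* If some set maximizing $\overline{re}$ over nonempty subsets of $\mathbb{S}$ has cardinality $k^*\ge3$, then $\{1,2,\dots,k^*\}$ maximizes $\overline{re}$ over nonempty subsets of $\mathbb{S}$ (no assumption on the size of the equilibrium demands is needed).
   Context: Market model: sellers $\mathbb{S}=\{1,\dots,n\}$, product qualities $\theta_1\ge\dots\ge\theta_n\ge0$. For displayed set $S$ and prices $p_i\ge0$: $a_i=e^{\theta_i-p_i}$, MNL demand $q_i=a_i/(1+\sum_{j\in S}a_j)$; sellers in $S$ play the Bertrand game (seller $i$ chooses $p_i\ge0$ to maximize $p_iq_i$). $V:(0,\infty)\to(0,1)$: $V(x)=$ the unique $v\in(0,1)$ with $v\exp(v/(1-v))=x$. For nonempty $S$, $\bar q_0(S)\in(0,1)$ is the unique solution of $\sum_{i\in S}V(\bar q_0e^{\theta_i-1})=1-\bar q_0$, $\bar q_i(S)=V(\bar q_0(S)e^{\theta_i-1})$, and $\overline{re}(S)=\sum_{i\in S}\frac{\bar q_i(S)}{1-\bar q_i(S)}$. *)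

(* Defs.v *)
From Stdlib Require Import Reals Lra Lia List ClassicalEpsilon.
Import ListNotations.
Open Scope R_scope.

Definition sumR (l : list nat) (f : nat -> R) : R :=
  fold_right (fun i acc => f i + acc) 0 l.

(* V(x) = the unique v in (0,1) with v * exp(v/(1-v)) = x  (x > 0) *)
Definition V (x : R) : R :=
  epsilon (inhabits 0) (fun v => 0 < v < 1 /\ v * exp (v / (1 - v)) = x).

(* \bar q_0(S): the unique q in (0,1) with sum_{i in S} V(q e^{theta_i - 1}) = 1 - q *)
Definition qbar0 (theta : nat -> R) (S : list nat) : R :=
  epsilon (inhabits 0)
    (fun q => 0 < q < 1 /\ sumR S (fun i => V (q * exp (theta i - 1))) = 1 - q).

Definition qbar (theta : nat -> R) (S : list nat) (i : nat) : R :=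
  V (qbar0 theta S * exp (theta i - 1)).

Definition re_bar (theta : nat -> R) (S : list nat) : R :=
  sumR S (fun i => qbar theta S i / (1 - qbar theta S i)).

Definition nonempty_subset (n : nat) (S : list nat) : Prop :=
  S <> [] /\ NoDup S /\ (forall i, In i S -> (1 <= i <= n)%nat).

Definition maximizes_re (n : nat) (theta : nat -> R) (S : list nat) : Prop :=
  nonempty_subset n S /\
  forall T, nonempty_subset n T -> re_bar theta T <= re_bar theta S.

(* Main.v *)
(** Write q_0 = exp t and W s = V (exp s); then W' = W (1 - phi W) with
    phi v = v / (1 - v + v^2). Fix the other displayed sellers L and let the
    quality of one seller i vary. Its demand is 1 - A with
    A t = exp t + sum_(l in L) W (t + theta_l - 1), so raising theta_i lowers t,
    and the objective becomes
      R t = sum_L W / (1 - W) + 1 / A - 1,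
      A R' = sum_L phi W (A + W / A) - 1.
    Each summand on the right is strictly increasing as long as A <= 1, so R is
    strictly quasiconvex. Hence replacing i by a strictly better j, or else
    dropping i, strictly improves the objective. An optimal set with at least
    two sellers therefore has the same qualities, with multiplicity, as the top
    set of the same size, and the objective only depends on the qualities. *)
Require Import Defs.
From Stdlib Require Import Reals List.
From Stdlib Require Import Lra Lia Permutation ClassicalEpsilon.
From Coquelicot Require Import Coquelicot.
Import ListNotations.
Open Scope R_scope.

(** * Sums over lists and a monotonicity criterion *)

Lemma sumR_ext (l : list nat) (f g : nat -> R) :
  (forall i, In i l -> f i = g i) -> sumR l f = sumR l g.
Proof.
  induction l as [|a l IH]; simpl; intros H; [reflexivity|].
  rewrite H, IH; auto.
Qed.

Lemma sumR_perm (l l' : list nat) (f : nat -> R) :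
  Permutation l l' -> sumR l f = sumR l' f.
Proof. induction 1; simpl in *; lra. Qed.

Lemma sumR_app (l l' : list nat) (f : nat -> R) :
  sumR (l ++ l') f = sumR l f + sumR l' f.
Proof. induction l; simpl in *; lra. Qed.

Lemma sumR_const (l : list nat) (f : nat -> R) (x : R) :
  (forall i, In i l -> f i = x) -> sumR l f = INR (length l) * x.
Proof.
  induction l as [|a l IH]; intros H; [simpl; lra|].
  change (f a + sumR l f = INR (S (length l)) * x).
  rewrite S_INR, IH, (H a); [ring| |]; simpl in *; auto.
Qed.

Lemma sumR_scal (l : list nat) (f : nat -> R) (x : R) :
  sumR l (fun i => x * f i) = x * sumR l f.
Proof. induction l as [|a l IH]; simpl in *; [|rewrite IH]; ring. Qed.

Lemma sumR_plus (l : list nat) (f g : nat -> R) :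
  sumR l (fun i => f i + g i) = sumR l f + sumR l g.
Proof. induction l as [|a l IH]; simpl in *; lra. Qed.

Lemma sumR_le (l : list nat) (f g : nat -> R) :
  (forall i, In i l -> f i <= g i) -> sumR l f <= sumR l g.
Proof.
  induction l as [|a l IH]; simpl; intros H; [lra|].
  apply Rplus_le_compat; auto.
Qed.

Lemma sumR_lt (l : list nat) (f g : nat -> R) :
  l <> [] -> (forall i, In i l -> f i < g i) -> sumR l f < sumR l g.
Proof.
  destruct l as [|a l]; simpl; intros Hl H; [easy|].
  apply Rplus_lt_le_compat; [auto|].
  apply sumR_le; intros i Hi; apply Rlt_le; auto.
Qed.

Lemma sumR_ge_member (l : list nat) (f : nat -> R) (i : nat) :
  (forall j, In j l -> 0 <= f j) -> In i l -> f i <= sumR l f.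
Proof.
  induction l as [|a l IH]; simpl; intros H Hi; [easy|].
  assert (0 <= sumR l f).
  { replace 0 with (sumR l (fun _ => 0)).
    - apply sumR_le; auto.
    - rewrite (sumR_const l _ 0); auto; ring. }
  specialize (H a (or_introl eq_refl)) as Ha.
  change (f i <= f a + sumR l f).
  destruct Hi as [->|Hi]; [lra|].
  specialize (IH (fun j Hj => H j (or_intror Hj)) Hi); lra.
Qed.

Lemma is_derive_sumR (l : list nat) (f : nat -> R -> R) (df : nat -> R) (t : R) :
  (forall i, In i l -> is_derive (f i) t (df i)) ->
  is_derive (fun s => sumR l (fun i => f i s)) t (sumR l df).
Proof.
  induction l as [|a l IH]; simpl; intros H.
  - apply @is_derive_const.
  - apply @is_derive_plus; auto.
Qed.

Lemma ex_derive_continuity_pt (f : R -> R) (x : R) :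
  ex_derive f x -> continuity_pt f x.
Proof.
  intros H. apply continuity_pt_filterlim, (ex_derive_continuous f x H).
Qed.

(** Positivity of the derivative is asked only in the open interval, so that the derivative may
    vanish at an end point, as it can at [t2] in [surplus_quasiconvex]. *)
Lemma derive_pos_lt (f df : R -> R) (a b : R) :
  a < b ->
  (forall x, a <= x <= b -> is_derive f x (df x)) ->
  (forall x, a < x < b -> 0 < df x) -> f a < f b.
Proof.
  intros Hab Hd Hp.
  destruct (MVT_cor2 f df a b Hab) as [c [E Hc]].
  - intros x Hx. apply is_derive_Reals, Hd, Hx.
  - assert (0 < df c * (b - a)) by (apply Rmult_lt_0_compat; [apply Hp|]; lra).
    lra.
Qed.

(** * The demand function in logarithmic coordinates and its derivative *)

(* The substitution v = u / (1 + u) moves the singularity at v = 1 to infinity. *)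
Lemma mulexp_surj (x : R) :
  0 < x -> exists v, 0 < v < 1 /\ v * exp (v / (1 - v)) = x.
Proof.
  intros Hx.
  destruct (IVT_cor (fun u => u * exp u - x * (1 + u)) 0 x) as [u [Hu E]].
  - intros u. apply ex_derive_continuity_pt. auto_derive; auto.
  - lra.
  - assert (x * (1 + x) <= x * exp x).
    { apply Rmult_le_compat_l; [lra|]. pose proof (exp_ineq1 x); lra. }
    rewrite exp_0. nra.
  - assert (0 < u).
    { destruct (Req_dec u 0) as [->|]; [|lra]. rewrite exp_0 in E. lra. }
    exists (u / (1 + u)). split.
    + split; [apply Rdiv_lt_0_compat; lra|].
      apply Rmult_lt_reg_r with (1 + u); [lra|]. unfold Rdiv; rewrite Rmult_assoc, Rinv_l; lra.
    + replace (u / (1 + u) / (1 - u / (1 + u))) with u by (field; lra).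
      replace x with (u * exp u / (1 + u)); [field; lra|].
      replace (u * exp u) with (x * (1 + u)) by lra. field. lra.
Qed.

(** The logarithmic argument turns the factor [exp (theta i - 1)] inside [V] into a translation of
    [t]. *)
Definition W (s : R) : R := V (exp s).

Lemma W_spec (s : R) :
  0 < W s < 1 /\ W s * exp (W s / (1 - W s)) = exp s.
Proof.
  unfold W, V. apply epsilon_spec. apply mulexp_surj, exp_pos.
Qed.

Lemma W_range (s : R) : 0 < W s < 1.
Proof. apply W_spec. Qed.

Lemma W_log (s : R) : ln (W s) + W s / (1 - W s) = s.
Proof.
  destruct (W_spec s) as [H E].
  rewrite <- (ln_exp (W s / (1 - W s))), <- ln_mult, E, ln_exp; auto using exp_pos.
  lra.
Qed.

Lemma W_le_exp (s : R) : W s <= exp s.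
Proof.
  destruct (W_spec s) as [H E]. rewrite <- E.
  assert (0 < W s / (1 - W s)) by (apply Rdiv_lt_0_compat; lra).
  pose proof (exp_ineq1 (W s / (1 - W s))).
  nra.
Qed.

Definition phi (v : R) : R := v / (1 - v + v ^ 2).

(* v (1 - phi v) is the reciprocal of the derivative of ln v + v / (1 - v). *)
Lemma W_increment (s s' : R) :
  exists x, Rmin (W s) (W s') <= x <= Rmax (W s) (W s') /\
    W s' - W s = x * (1 - phi x) * (s' - s).
Proof.
  pose proof (W_range s). pose proof (W_range s').
  assert (Hr : forall x, Rmin (W s) (W s') <= x <= Rmax (W s) (W s') -> 0 < x < 1).
  { intros x. unfold Rmin, Rmax. destruct Rle_dec; lra. }
  assert (Hd : forall x, 0 < x < 1 ->
    is_derive (fun v => ln v + v / (1 - v)) x (1 / x + 1 / (1 - x) ^ 2)).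
  { intros x Hx. auto_derive; [lra|]. field. lra. }
  destruct (MVT_gen (fun v => ln v + v / (1 - v)) (W s) (W s')
    (fun x => 1 / x + 1 / (1 - x) ^ 2)) as [x [Hx E]].
  - intros x Hx. apply Hd, Hr. lra.
  - intros x Hx. apply ex_derive_continuity_pt. eexists. apply Hd, Hr, Hx.
  - exists x. split; [exact Hx|]. apply Hr in Hx. rewrite !W_log in E.
    rewrite E. unfold phi. field. repeat split; try lra; nra.
Qed.

Lemma phi_range (v : R) : 0 < v < 1 -> 0 < phi v < 1.
Proof.
  intros H. unfold phi. assert (0 < 1 - v + v ^ 2) by nra. split.
  - apply Rdiv_lt_0_compat; lra.
  - apply Rmult_lt_reg_r with (1 - v + v ^ 2); [lra|]. field_simplify; nra.
Qed.

Lemma is_derive_phi (v : R) :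
  is_derive phi v ((1 - v ^ 2) / (1 - v + v ^ 2) ^ 2).
Proof.
  assert (0 < 1 - v + v ^ 2) by nra.
  unfold phi. auto_derive; [lra|]. field. lra.
Qed.

(** By [W_increment] the difference quotient is [psi x] for some [x] between the two values of [W].
    Since [psi] lies in (0,1), the same identity gives |W (s + h) - W s| <= |h|. Hence [x] is within
    |h| of [W s], and continuity of [psi] finishes. *)
Lemma is_derive_W (s : R) : is_derive W s (W s * (1 - phi (W s))).
Proof.
  apply is_derive_Reals. intros eps Heps.
  set (psi := fun v => v * (1 - phi v)).
  assert (Hc : continuity_pt psi (W s)).
  { apply ex_derive_continuity_pt. unfold psi.
    apply @ex_derive_mult; [apply ex_derive_id|].
    apply @ex_derive_minus; [apply ex_derive_const|].
    eexists; apply is_derive_phi. }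
  destruct (Hc eps Heps) as [d [Hd Hpsi]].
  exists (mkposreal d Hd). intros h Hh0 Hh. simpl in Hh.
  destruct (W_increment s (s + h)) as [x [Hx E]].
  replace ((W (s + h) - W s) / h) with (psi x)
    by (rewrite E; unfold psi; field; lra).
  change (Rabs (psi x - psi (W s)) < eps).
  destruct (Req_dec x (W s)) as [->|Hne].
  { rewrite Rminus_diag, Rabs_R0. exact Heps. }
  apply Hpsi. split; [split; [exact I|auto]|].
  simpl. unfold Rdist.
  pose proof (W_range s). pose proof (W_range (s + h)).
  assert (Hx01 : 0 < x < 1) by (revert Hx; unfold Rmin, Rmax; destruct Rle_dec; lra).
  pose proof (phi_range x Hx01).
  assert (0 < x * (1 - phi x) < 1) by (split; nra).
  apply Rle_lt_trans with (Rabs (W (s + h) - W s)).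
  { revert Hx. unfold Rmin, Rmax. destruct Rle_dec; intros Hx.
    - rewrite !Rabs_right; lra.
    - rewrite !Rabs_left1; lra. }
  rewrite E, Rabs_mult. replace (s + h - s) with h by ring.
  rewrite (Rabs_right (x * _)) by lra.
  pose proof (Rabs_pos h). nra.
Qed.

Lemma is_derive_W_shift (c t : R) :
  is_derive (fun t => W (t + c)) t (W (t + c) * (1 - phi (W (t + c)))).
Proof.
  evar_last.
  - apply (is_derive_comp W (fun t => t + c)); [apply is_derive_W|].
    auto_derive; auto.
  - unfold scal; simpl; unfold mult; simpl. ring.
Qed.

Lemma W_lt (s s' : R) : s < s' -> W s < W s'.
Proof.
  intros H. apply (derive_pos_lt W _ s s' H (fun x _ => is_derive_W x)).
  intros x _. pose proof (W_range x). pose proof (phi_range _ H0). nra.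
Qed.

(** * Total market share as a function of ln q_0 *)

(** With [c = shift theta], the equation [mass c S t = 1] is the one defining [qbar0 theta S], read
    at q_0 = exp t. *)
Definition mass (c : nat -> R) (L : list nat) (t : R) : R :=
  exp t + sumR L (fun i => W (t + c i)).

Lemma is_derive_mass (c : nat -> R) (L : list nat) (t : R) :
  is_derive (mass c L) t
    (exp t + sumR L (fun i => W (t + c i) * (1 - phi (W (t + c i))))).
Proof.
  apply @is_derive_plus.
  - auto_derive; auto; ring.
  - apply is_derive_sumR. intros. apply is_derive_W_shift.
Qed.

Lemma mass_derive_eq (c : nat -> R) (L : list nat) (t : R) :
  exp t + sumR L (fun i => W (t + c i) * (1 - phi (W (t + c i)))) =
  mass c L t - sumR L (fun i => W (t + c i) * phi (W (t + c i))).
Proof.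
  unfold mass.
  rewrite (sumR_ext L _
    (fun i => W (t + c i) + -1 * (W (t + c i) * phi (W (t + c i)))))
    by (intros; ring).
  rewrite sumR_plus, sumR_scal. ring.
Qed.

Lemma mass_lt (c : nat -> R) (L : list nat) (t t' : R) :
  t < t' -> mass c L t < mass c L t'.
Proof.
  intros H. apply Rplus_lt_le_compat; [apply exp_increasing, H|].
  apply sumR_le. intros i _. apply Rlt_le, W_lt. lra.
Qed.

Lemma mass_lt_inv (c : nat -> R) (L : list nat) (t t' : R) :
  mass c L t < mass c L t' -> t < t'.
Proof.
  intros H. destruct (Rtotal_order t t') as [H'|[->|H']]; auto; [lra|].
  apply (mass_lt c L) in H'. lra.
Qed.

Lemma mass_gt_member (c : nat -> R) (L : list nat) (t : R) (i : nat) :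
  In i L -> W (t + c i) < mass c L t.
Proof.
  intros Hi. unfold mass. pose proof (exp_pos t).
  pose proof (sumR_ge_member L (fun i => W (t + c i)) i) as H1. simpl in H1.
  assert (forall j, In j L -> 0 <= W (t + c j))
    by (intros j _; pose proof (W_range (t + c j)); lra).
  specialize (H1 H0 Hi). lra.
Qed.

Lemma mass_pos (c : nat -> R) (L : list nat) (t : R) : 0 < mass c L t.
Proof.
  unfold mass. pose proof (exp_pos t).
  assert (sumR L (fun _ => 0) <= sumR L (fun i => W (t + c i))).
  { apply sumR_le. intros i _. apply Rlt_le, W_range. }
  rewrite (sumR_const L _ 0) in H0; auto. lra.
Qed.

(** * Monotone slope terms and strict quasiconvexity of the surplus *)

(* [a'] stands for the derivative of the mass [a] in the logarithm of q_0.
   The quantity is affine in [a'], so its sign is checked at the end points;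
   with r = v / a the upper one amounts to
   (1 - r)^2 (1 + r) + (r - v) (1 - v) >= 0. *)
Lemma slope_term_ineq (v a a' : R) :
  0 < v < 1 -> v < a -> a <= 1 -> 0 <= a' -> a' <= a - v * phi v ->
  0 <= a' * (1 - v / a ^ 2) + v / a * (1 - phi v).
Proof.
  intros Hv Hva Ha Ha0 Ha1.
  pose proof (phi_range v Hv) as Hp.
  assert (Hr : 0 < v / a) by (apply Rdiv_lt_0_compat; lra).
  destruct (Rle_dec 0 (1 - v / a ^ 2)) as [H|H].
  { apply Rplus_le_le_0_compat; apply Rmult_le_pos; lra. }
  apply Rle_trans with ((a - v * phi v) * (1 - v / a ^ 2) + v / a * (1 - phi v)).
  2: { nra. }
  set (r := v / a) in *.
  assert (Hr1 : r < 1).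
  { unfold r. apply Rmult_lt_reg_r with a; [lra|]. field_simplify; lra. }
  assert (Hrv : v <= r).
  { unfold r. apply Rmult_le_reg_r with a; [lra|]. field_simplify; nra. }
  assert (Hq : 0 < 1 - v + v ^ 2) by nra.
  replace ((a - v * phi v) * (1 - v / a ^ 2) + r * (1 - phi v))
    with (((1 - r) ^ 2 * (1 + r) + (r - v) * (1 - v)) * a / (1 - v + v ^ 2))
    by (unfold r, phi; field; lra).
  apply Rmult_le_pos; [apply Rmult_le_pos; [|lra]|apply Rlt_le, Rinv_0_lt_compat; lra].
  apply Rplus_le_le_0_compat; apply Rmult_le_pos; try lra.
  apply pow2_ge_0.
Qed.

Definition slope_term (c : nat -> R) (L : list nat) (i : nat) (t : R) : R :=
  phi (W (t + c i)) * (mass c L t + W (t + c i) / mass c L t).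

(** The derivative is grouped as phi v (a + v / a)' + (phi v)' (a + v / a). The first product is
    nonnegative by [slope_term_ineq], the second is positive. *)
Lemma slope_term_lt (c : nat -> R) (L : list nat) (i : nat) (t t' : R) :
  In i L -> t < t' -> mass c L t' <= 1 ->
  slope_term c L i t < slope_term c L i t'.
Proof.
  intros Hi Htt Hm.
  set (da := fun x => exp x +
    sumR L (fun i => W (x + c i) * (1 - phi (W (x + c i))))).
  set (df := fun x => let v := W (x + c i) in let a := mass c L x in
    phi v * (da x * (1 - v / a ^ 2) + v / a * (1 - phi v)) +
    (1 - v ^ 2) / (1 - v + v ^ 2) ^ 2 * (v * (1 - phi v)) * (a + v / a)).
  apply (derive_pos_lt (slope_term c L i) df); auto.
  - intros x _. pose proof (mass_pos c L x).
    unfold slope_term.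
    pose proof (is_derive_comp phi (fun t => W (t + c i)) x _ _
      (is_derive_phi _) (is_derive_W_shift (c i) x)) as D1.
    pose proof (is_derive_W_shift (c i) x) as D2.
    pose proof (is_derive_mass c L x) as D3. fold (da x) in D3.
    evar_last.
    + apply @is_derive_mult; [exact D1| |intros; apply Rmult_comm].
      apply @is_derive_plus; [exact D3|].
      apply is_derive_div; [exact D2|exact D3|lra].
    + unfold df, plus, scal, mult; simpl; unfold mult; simpl. field.
      split; [lra|]. pose proof (W_range (x + c i)). nra.
  - intros x Hx. unfold df. cbv zeta.
    assert (Hmx : mass c L x <= 1).
    { destruct (Req_dec x t') as [->|]; auto.
      pose proof (mass_lt c L x t'). lra. }
    pose proof (W_range (x + c i)) as Hv.
    pose proof (mass_gt_member c L x i Hi) as Hva.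
    pose proof (phi_range _ Hv) as Hp.
    assert (Hq : 0 < 1 - W (x + c i) + W (x + c i) ^ 2) by nra.
    assert (H0 : 0 <= da x).
    { unfold da. pose proof (exp_pos x).
      assert (sumR L (fun _ => 0) <=
        sumR L (fun i => W (x + c i) * (1 - phi (W (x + c i))))).
      { apply sumR_le. intros j _. pose proof (W_range (x + c j)).
        pose proof (phi_range _ H0). apply Rmult_le_pos; lra. }
      rewrite (sumR_const L _ 0) in H0; auto. lra. }
    (* In the form of [mass_derive_eq], only the term of seller [i] is kept from the subtracted sum
       of nonnegative terms. *)
    assert (H1 : da x <= mass c L x - W (x + c i) * phi (W (x + c i))).
    { unfold da. rewrite mass_derive_eq.
      pose proof (sumR_ge_member L
        (fun i => W (x + c i) * phi (W (x + c i))) i) as H1. simpl in H1.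
      assert (H2 : forall j, In j L -> 0 <= W (x + c j) * phi (W (x + c j))).
      { intros j _. pose proof (W_range (x + c j)).
        pose proof (phi_range _ H). apply Rmult_le_pos; lra. }
      specialize (H1 H2 Hi). lra. }
    pose proof (slope_term_ineq _ _ _ Hv Hva Hmx H0 H1) as Hk.
    apply Rplus_le_lt_0_compat.
    + apply Rmult_le_pos; lra.
    + repeat apply Rmult_lt_0_compat; try lra.
      * nra.
      * apply Rinv_0_lt_compat, pow_lt, Hq.
      * apply Rplus_lt_0_compat; [lra|apply Rdiv_lt_0_compat; lra].
Qed.

(* The surplus of the sellers in [L] at q_0 = exp t, plus that of one further
   seller whose demand 1 - mass c L t clears the market. *)
Definition surplus (c : nat -> R) (L : list nat) (t : R) : R :=
  sumR L (fun i => W (t + c i) / (1 - W (t + c i))) + (1 / mass c L t - 1).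

(** Since 1 - phi v = (1 - v)^2 / (1 - v + v^2), each W / (1 - W) has derivative phi W. Rewriting
    the derivative of the mass by [mass_derive_eq] lets 1 / [mass] contribute the remaining
    terms. *)
Lemma is_derive_surplus (c : nat -> R) (L : list nat) (t : R) :
  is_derive (surplus c L) t
    ((sumR L (fun i => slope_term c L i t) - 1) / mass c L t).
Proof.
  pose proof (mass_pos c L t) as Hm.
  pose proof (is_derive_mass c L t) as D. rewrite mass_derive_eq in D.
  evar_last.
  - apply @is_derive_plus.
    + apply is_derive_sumR with (df := fun i => phi (W (t + c i))).
      intros i _. pose proof (W_range (t + c i)) as Hv.
      evar_last.
      * apply (is_derive_comp (fun v => v / (1 - v)) (fun t => W (t + c i)) t
          (1 / (1 - W (t + c i)) ^ 2)); [|apply is_derive_W_shift].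
        auto_derive; [lra|]. field. lra.
      * unfold scal; simpl; unfold mult; simpl. unfold phi. field.
        split; nra.
    + apply @is_derive_minus; [|apply @is_derive_const].
      apply is_derive_div; [apply @is_derive_const|exact D|lra].
  - unfold plus, minus, opp, zero; simpl; unfold plus, opp, zero; simpl.
    unfold slope_term.
    rewrite (sumR_ext L (fun i => phi (W (t + c i)) *
        (mass c L t + W (t + c i) / mass c L t))
      (fun i => mass c L t * phi (W (t + c i)) +
         / mass c L t * (W (t + c i) * phi (W (t + c i)))))
      by (intros; field; lra).
    rewrite sumR_plus, !sumR_scal. field. lra.
Qed.

Lemma surplus_quasiconvex (c : nat -> R) (L : list nat) (t1 t2 t3 : R) :
  L <> [] -> t1 < t2 -> t2 < t3 -> mass c L t3 <= 1 ->
  surplus c L t2 < surplus c L t3 \/ surplus c L t2 < surplus c L t1.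
Proof.
  intros HL H12 H23 Hm.
  set (N := fun t => sumR L (fun i => slope_term c L i t) - 1).
  assert (HN : forall x y, x < y -> y <= t3 -> N x < N y).
  { intros x y Hxy Hy. apply Rplus_lt_compat_r, sumR_lt; auto.
    intros i Hi. apply slope_term_lt; auto.
    destruct (Req_dec y t3) as [->|]; auto.
    pose proof (mass_lt c L y t3). lra. }
  (* [N] has the sign of the derivative and is strictly increasing up to [t3]: if positive at [t2]
     it stays positive to the right, otherwise it is negative to the left of [t2]. *)
  destruct (Rlt_le_dec 0 (N t2)) as [H|H].
  - left. apply derive_pos_lt with (df := fun t => N t / mass c L t); auto.
    + intros x _. apply is_derive_surplus.
    + intros x Hx. apply Rdiv_lt_0_compat; [|apply mass_pos].
      pose proof (HN t2 x). lra.
  - right. apply Ropp_lt_cancel.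
    apply derive_pos_lt with (f := fun t => - surplus c L t)
      (df := fun t => - (N t / mass c L t)); auto.
    + intros x _. apply @is_derive_opp, is_derive_surplus.
    + intros x Hx. rewrite <- Rdiv_opp_l.
      apply Rdiv_lt_0_compat; [|apply mass_pos].
      pose proof (HN x t2). lra.
Qed.

(** * Equilibria and the effect of exchanging one seller *)

Lemma equilibrium_exists (c : nat -> R) (S : list nat) :
  S <> [] -> exists t, t < 0 /\ mass c S t = 1.
Proof.
  intros HS.
  set (K := sumR S (fun i => exp (c i))).
  assert (HK : 0 <= K).
  { rewrite <- (Rmult_0_r (INR (length S))), <- (sumR_const S (fun _ => 0)); auto.
    apply sumR_le. intros; apply Rlt_le, exp_pos. }
  assert (H0 : 1 < mass c S 0).
  { unfold mass. rewrite exp_0.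
    assert (sumR S (fun _ => 0) < sumR S (fun i => W (0 + c i))).
    { apply sumR_lt; auto. intros; apply W_range. }
    rewrite (sumR_const S _ 0) in H; auto. lra. }
  (* The left end point comes from W <= exp, which bounds the mass at [a] by exp a * (1 + K). *)
  assert (Ha : mass c S (- ln (1 + K)) <= 1).
  { unfold mass. set (a := - ln (1 + K)).
    assert (sumR S (fun i => W (a + c i)) <= exp a * K).
    { unfold K. rewrite <- sumR_scal. apply sumR_le. intros i _.
      rewrite <- exp_plus. apply W_le_exp. }
    assert (exp a * (1 + K) = 1).
    { unfold a. rewrite exp_Ropp, exp_ln by lra. field. lra. }
    lra. }
  destruct (IVT_cor (fun t => mass c S t - 1) (- ln (1 + K)) 0) as [t [_ E]].
  - intros t. apply ex_derive_continuity_pt.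
    apply @ex_derive_minus; [|apply ex_derive_const].
    eexists; apply is_derive_mass.
  - apply Rlt_le, (mass_lt_inv c S). lra.
  - nra.
  - exists t. split; [apply (mass_lt_inv c S)|]; lra.
Qed.

Definition shift (theta : nat -> R) (i : nat) : R := theta i - 1.

(** Strict monotonicity of [mass] makes the equilibrium unique, so the value chosen by [epsilon] in
    [qbar0] must be [exp t]. *)
Lemma re_bar_eq (theta : nat -> R) (S : list nat) (t : R) :
  S <> [] -> mass (shift theta) S t = 1 ->
  re_bar theta S =
  sumR S (fun i => W (t + shift theta i) / (1 - W (t + shift theta i))).
Proof.
  intros HS Ht.
  set (P := fun q => 0 < q < 1 /\
    sumR S (fun i => V (q * exp (theta i - 1))) = 1 - q).
  assert (HP : forall s, s < 0 -> mass (shift theta) S s = 1 -> P (exp s)).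
  { intros s Hs E. split.
    - split; [apply exp_pos|]. rewrite <- exp_0. apply exp_increasing, Hs.
    - replace (1 - exp s) with (sumR S (fun i => W (s + shift theta i)))
        by (unfold mass in E; lra).
      apply sumR_ext.
      intros; unfold W, shift; rewrite exp_plus; reflexivity. }
  destruct (equilibrium_exists (shift theta) S HS) as [s [Hs Es]].
  assert (Hq : P (qbar0 theta S)).
  { unfold qbar0. apply epsilon_spec. exists (exp s). apply (HP s Hs Es). }
  destruct Hq as [[Hq0 Hq1] Hq].
  assert (E : qbar0 theta S = exp t).
  { rewrite <- (exp_ln (qbar0 theta S)) by auto. f_equal.
    set (u := ln (qbar0 theta S)).
    assert (Eu : mass (shift theta) S u = 1).
    { unfold mass, W. rewrite (sumR_ext S _
        (fun i => V (qbar0 theta S * exp (theta i - 1)))).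
      - rewrite Hq. unfold u. rewrite exp_ln by auto. ring.
      - intros. unfold u, shift. rewrite exp_plus, exp_ln by auto. reflexivity. }
    destruct (Rtotal_order u t) as [H|[H|H]]; auto;
      apply (mass_lt (shift theta) S) in H; lra. }
  unfold re_bar. apply sumR_ext. intros i _. unfold qbar, W, shift.
  rewrite E, exp_plus. reflexivity.
Qed.

(** Market clearing forces the demand of [i] to be 1 - A with A = [mass (shift theta) L t], so its
    summand is (1 - A) / A = 1 / A - 1. The quality of [i] then enters only through [t]. *)
Lemma re_bar_cons (theta : nat -> R) (L : list nat) (i : nat) (t : R) :
  mass (shift theta) (i :: L) t = 1 ->
  re_bar theta (i :: L) = surplus (shift theta) L t.
Proof.
  intros E. rewrite (re_bar_eq _ _ t) by easy.
  assert (H : W (t + shift theta i) = 1 - mass (shift theta) L t).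
  { rewrite <- E. unfold mass. simpl. unfold sumR. ring. }
  simpl. unfold surplus. rewrite H. unfold sumR.
  pose proof (mass_pos (shift theta) L t). field. lra.
Qed.

(** Dropping the extra seller is the end point A = 1 of the same curve, where its contribution 1 / A
    - 1 vanishes. *)
Lemma re_bar_tail (theta : nat -> R) (L : list nat) (t : R) :
  L <> [] -> mass (shift theta) L t = 1 ->
  re_bar theta L = surplus (shift theta) L t.
Proof.
  intros HL E. rewrite (re_bar_eq _ _ t) by easy.
  unfold surplus. rewrite E. field.
Qed.

(** The displays [j :: L], [i :: L] and [L] have equilibria t1 < t2 < t3 on one surplus curve of
    [L], and quasiconvexity excludes a maximum at the middle one. *)
Lemma re_bar_swap_lt (theta : nat -> R) (L : list nat) (i j : nat) :
  L <> [] -> theta i < theta j ->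
  re_bar theta (i :: L) < re_bar theta L \/
  re_bar theta (i :: L) < re_bar theta (j :: L).
Proof.
  intros HL Hij. set (c := shift theta).
  destruct (equilibrium_exists c (j :: L)) as [t1 [_ E1]]; [easy|].
  destruct (equilibrium_exists c (i :: L)) as [t2 [_ E2]]; [easy|].
  destruct (equilibrium_exists c L HL) as [t3 [_ E3]].
  assert (Hcons : forall k t,
    mass c (k :: L) t = W (t + c k) + mass c L t).
  { intros. unfold mass. simpl. unfold sumR. ring. }
  assert (H23 : t2 < t3).
  { apply (mass_lt_inv c L). rewrite Hcons in E2.
    pose proof (W_range (t2 + c i)). lra. }
  assert (H12 : t1 < t2).
  { apply (mass_lt_inv c (j :: L)). rewrite E1, <- E2, !Hcons.
    apply Rplus_lt_compat_r, W_lt. unfold c, shift. lra. }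
  rewrite (re_bar_cons _ _ i t2 E2), (re_bar_cons _ _ j t1 E1),
    (re_bar_tail _ _ t3 HL E3).
  apply surplus_quasiconvex; auto. fold c. lra.
Qed.

(** Equality of the multisets of qualities is encoded as equality of the sums of every function of
    the quality. It is applied to the demands, to share the equilibrium, and to the summands of the
    objective. *)
Lemma re_bar_theta_sums (theta : nat -> R) (S T : list nat) :
  S <> [] -> (forall f : R -> R, sumR S (fun i => f (theta i)) =
    sumR T (fun i => f (theta i))) -> T <> [] ->
  re_bar theta S = re_bar theta T.
Proof.
  intros HS H HT.
  destruct (equilibrium_exists (shift theta) S HS) as [t [_ E]].
  rewrite (re_bar_eq _ S t HS E), (re_bar_eq _ T t HT).
  - apply (H (fun x => W (t + (x - 1)) / (1 - W (t + (x - 1))))).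
  - rewrite <- E. unfold mass. f_equal. symmetry.
    apply (H (fun x => W (t + (x - 1)))).
Qed.

(** * Comparison of a maximizer with the top sellers *)

Lemma maximizer_dominates (n : nat) (theta : nat -> R) (S : list nat) (i j : nat) :
  maximizes_re n theta S -> (2 <= length S)%nat -> In i S -> ~ In j S ->
  (1 <= j <= n)%nat -> theta j <= theta i.
Proof.
  intros [[_ [Hnd Hin]] Hmax] Hlen Hi Hj Hjn.
  apply Rnot_lt_le. intros Hlt.
  apply in_split in Hi. destruct Hi as [l1 [l2 ->]].
  pose proof (Permutation_middle l1 l2 i) as HP.
  set (L := l1 ++ l2) in *.
  pose proof (Permutation_NoDup (Permutation_sym HP) Hnd) as Hnd'.
  inversion Hnd' as [|? ? HiL HndL]; subst.
  assert (HinL : forall k, In k L -> In k (l1 ++ i :: l2)).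
  { intros k Hk. apply (Permutation_in _ HP). right; exact Hk. }
  (* A second seller in the set keeps [L] nonempty, so that [L] is itself an admissible
     competitor. *)
  assert (HL : L <> []).
  { intros E. rewrite <- (Permutation_length HP), E in Hlen. simpl in Hlen. lia. }
  assert (HE : re_bar theta (l1 ++ i :: l2) = re_bar theta (i :: L)).
  { apply re_bar_theta_sums; try easy.
    - apply not_eq_sym, app_cons_not_nil.
    - intros f. apply sumR_perm, Permutation_sym, HP. }
  rewrite HE in Hmax.
  destruct (re_bar_swap_lt theta L i j HL Hlt) as [H|H].
  - specialize (Hmax L). apply Rle_not_lt in Hmax; [easy|].
    repeat split; auto; apply Hin; auto.
  - specialize (Hmax (j :: L)). apply Rle_not_lt in Hmax; [easy|].
    repeat split; [easy| | |].
    + constructor; auto.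
    + destruct H0 as [<-|]; [lia|apply Hin; auto].
    + destruct H0 as [<-|]; [lia|apply Hin; auto].
Qed.

Lemma filter_partition (p : nat -> bool) (l : list nat) :
  Permutation l (filter p l ++ filter (fun i => negb (p i)) l).
Proof.
  induction l as [|a l IH]; simpl; [constructor|].
  destruct (p a); simpl.
  - constructor; exact IH.
  - apply Permutation_cons_app, IH.
Qed.

(** The common elements cancel. The two differences have equal length, and [f] takes a single value
    on both, because each element of one is matched with each element of the other. *)
Lemma sumR_exchange (S T : list nat) (f : nat -> R) :
  NoDup S -> NoDup T -> length S = length T ->
  (forall i j, In i S -> ~ In i T -> In j T -> ~ In j S -> f i = f j) ->
  sumR S f = sumR T f.
Proof.
  intros HS HT Hlen H.
  set (mem := fun l i => if in_dec Nat.eq_dec i l then true else false).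
  assert (Hmem : forall l i, mem l i = true <-> In i l).
  { intros l i. unfold mem. destruct in_dec; split; easy. }
  assert (Hmem' : forall l i, negb (mem l i) = true <-> ~ In i l).
  { intros l i. unfold mem. destruct in_dec; simpl; split; easy. }
  pose proof (filter_partition (mem T) S) as PS.
  pose proof (filter_partition (mem S) T) as PT.
  assert (PI : Permutation (filter (mem T) S) (filter (mem S) T)).
  { apply NoDup_Permutation; try apply NoDup_filter; auto.
    intros i. rewrite !filter_In, !Hmem. tauto. }
  rewrite (sumR_perm _ _ _ PS), (sumR_perm _ _ _ PT), !sumR_app.
  rewrite (sumR_perm _ _ _ PI). f_equal.
  apply Permutation_length in PS, PT, PI.
  rewrite length_app in PS, PT.
  set (S' := filter (fun i => negb (mem T i)) S) in *.
  set (T' := filter (fun i => negb (mem S i)) T) in *.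
  assert (HS' : forall i, In i S' -> In i S /\ ~ In i T).
  { intros i. unfold S'. rewrite filter_In, <- Hmem'. auto. }
  assert (HT' : forall i, In i T' -> In i T /\ ~ In i S).
  { intros i. unfold T'. rewrite filter_In, <- Hmem'. auto. }
  assert (Hl : length S' = length T') by lia.
  destruct S' as [|i S'], T' as [|j T']; try easy.
  destruct (HS' i (or_introl eq_refl)) as [Hi1 Hi2].
  destruct (HT' j (or_introl eq_refl)) as [Hj1 Hj2].
  rewrite (sumR_const _ f (f j)), (sumR_const _ f (f j)), Hl; auto.
  - intros k Hk. apply HT' in Hk. rewrite <- (H i j), <- (H i k); tauto.
  - intros k Hk. apply HS' in Hk. apply H; tauto.
Qed.

Theorem theorem9 (n : nat) (theta : nat -> R)
  (Hmono : forall i j : nat, (1 <= i)%nat -> (i <= j)%nat -> (j <= n)%nat -> theta j <= theta i)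
  (Hnonneg : forall i : nat, (1 <= i)%nat -> (i <= n)%nat -> 0 <= theta i)
  (S : list nat) (HS : maximizes_re n theta S) (Hk : (3 <= length S)%nat) :
  maximizes_re n theta (seq 1 (length S)).
Proof.
  pose proof HS as [[Hne [Hnd Hin]] Hmax].
  assert (Hkn : (length S <= n)%nat).
  { rewrite <- (length_seq n 1). apply NoDup_incl_length; auto.
    intros i Hi. apply in_seq. apply Hin in Hi. lia. }
  assert (Hseq : seq 1 (length S) <> []).
  { intros H. apply (f_equal (@length nat)) in H. rewrite length_seq in H.
    simpl in H. lia. }
  assert (Heq : re_bar theta S = re_bar theta (seq 1 (length S))).
  { apply re_bar_theta_sums; auto. intros f.
    apply sumR_exchange; auto.
    - apply seq_NoDup.
    - symmetry; apply length_seq.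
    - intros i j Hi Hi' Hj Hj'. f_equal.
      rewrite in_seq in Hi', Hj. pose proof (Hin i Hi).
      apply Rle_antisym.
      + apply Hmono; lia.
      + apply (maximizer_dominates n theta S); auto; lia. }
  split.
  - split; [exact Hseq|]. split; [apply seq_NoDup|].
    intros i Hi. apply in_seq in Hi. lia.
  - intros T HT. rewrite <- Heq. apply Hmax, HT.
Qed.
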